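(* If $R$ is a finite ring then \[ \Pr(R)\ge \frac{1}{|[R,R]|}\left(1+\frac{|[R,R]|-1}{|R:Z(R)|}\right). \] In particular, if $R$ is non-commutative then $\Pr(R)>\dfrac{1}{|[R,R]|}$.
   Context: Rings are associative and are not required to have an identity. For a finite ring $R$: $[R,R]$ is the subgroup of $(R,+)$ generated by all additive commutators $sr-rs$ with $s,r\in R$; $Z(R)$ is the center of $R$; $|R:Z(R)|$ is the index of $Z(R)$ in $(R,+)$; and $\Pr(R)=\dfrac{|\{(s,r)\in R\times R: sr=rs\}|}{|R|^2}$. *)

(* Defs.v *)
From HB Require Import structures.
From mathcomp Require Import all_boot all_order all_fingroup all_algebra.

Set Implicit Arguments.
Unset Strict Implicit.
Unset Printing Implicit Defensive.

Import GRing.Theory.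
Local Open Scope ring_scope.

(* The ring structures of ssralg all have a 1, so associative rings that need
   not have an identity get their own interface over zmodType. *)
HB.mixin Record Zmodule_isRng R of GRing.Zmodule R := {
  rngmul : R -> R -> R;
  rngmulA : associative rngmul;
  rngmulDl : left_distributive rngmul +%R;
  rngmulDr : right_distributive rngmul +%R
}.

#[short(type="finRngType")]
HB.structure Definition FinRng :=
  {R of FinRing.Zmodule R & Zmodule_isRng R}.

Notation "x ** y" := (rngmul x y) (at level 40, left associativity) : ring_scope.

(* As for the structures of finalg, the finGroupType operations on a finRngType
   are those of its additive group. *)
#[non_forgetful_inheritance]
HB.instance Definition _ (R : finRngType) := [finGroupMixin of R for +%R].

Section FiniteRngs.

Variable R : finRngType.

Lemma rngmul0l (x : R) : 0 ** x = 0.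
Proof. by apply: (addrI (0 ** x)); rewrite -rngmulDl !addr0. Qed.

Lemma rngmul0r (x : R) : x ** 0 = 0.
Proof. by apply: (addrI (x ** 0)); rewrite -rngmulDr !addr0. Qed.

(* << _ >>%g is the generated subgroup of (R, +). *)
Definition commutator_subgroup : {set R} :=
  << [set s ** r - r ** s | s : R, r : R] >>%g.

Definition rng_center : {set R} :=
  [set z : R | [forall x : R, z ** x == x ** z]].

Lemma rng_center_group_set : group_set rng_center.
Proof.
apply/group_setP; split.
  rewrite inE; apply/forallP => x; by rewrite rngmul0l rngmul0r.
move=> y z; rewrite !inE => /forallP yP /forallP zP; apply/forallP => x.
by rewrite rngmulDl rngmulDr (eqP (yP x)) (eqP (zP x)).
Qed.

Canonical rng_center_group := Group rng_center_group_set.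

Definition commuting_prob : rat :=
  #|[set sr : R * R | sr.1 ** sr.2 == sr.2 ** sr.1]|%:R / #|R|%:R ^+ 2.

End FiniteRngs.

Arguments commutator_subgroup R : clear implicits.
Arguments rng_center R : clear implicits.
Arguments commuting_prob R : clear implicits.

(* Main.v *)
Require Import Defs.
From HB Require Import structures.
From mathcomp Require Import all_boot all_order all_fingroup all_algebra.
From mathcomp Require Import ring.

Import Order.TTheory GRing.Theory Num.Theory.
Local Open Scope ring_scope.

(** Counting commuting pairs one left entry [s] at a time, [Pr(R)] is the
    average of [|C(s)| / |R|], where [C(s)] is the kernel of the additive
    endomorphism [r |-> s r - r s].  The image of this endomorphism lies in
    [[R,R]], so the first isomorphism theorem gives [|C(s)| >= |R| / |[R,R]|]
    ([card_le_centralizer_mul_commutator]).  A central [s] does better, with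
    [C(s) = R].  Adding up over the [|Z(R)|] central and the [|R| - |Z(R)|]
    non-central [s] ([commuting_pairs_lower_bound]) and dividing by
    [|[R,R]| |R|^2] gives the bound.  It exceeds [1 / |[R,R]|] as soon as
    [|[R,R]| > 1], that is, as soon as some commutator is nonzero. *)

Section CommutingPairs.

Variable R : finRngType.

Definition centralizer (s : R) : {set R} := [set r | s ** r == r ** s].

Definition ad (s r : R) : R := s ** r - r ** s.

Lemma ad_in_commutator_subgroup s r : ad s r \in commutator_subgroup R.
Proof. by apply: mem_gen; apply/imset2P; exists s r. Qed.

Lemma ad_morphic s : {in [set: R] &, {morph ad s : x y / (x * y)%g}}.
Proof.
(* The group law carried by [R] is its addition. *)
move=> x y _ _; change (ad s (x + y) = ad s x + ad s y).
by rewrite /ad rngmulDl rngmulDr opprD addrACA.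
Qed.

Canonical ad_morphism s := Morphism (ad_morphic s).

Lemma ker_ad s : ('ker (ad s))%g = centralizer s.
Proof.
apply/setP=> r; rewrite !inE /=.
(* The group identity is the zero of [R]. *)
by change ((ad s r == 0) = (s ** r == r ** s)); rewrite subr_eq0.
Qed.

(** By the first isomorphism theorem the index of [C(s)] in [R] is the size of
    the image of [ad s], a subset of [[R,R]]. *)
Lemma card_le_centralizer_mul_commutator s :
  (#|R| <= #|centralizer s| * #|commutator_subgroup R|)%N.
Proof.
rewrite -cardsT -(Lagrange (subsetT ('ker (ad s))%G)) -ker_ad leq_mul2l.
have := card_morphim (ad_morphism s) [set: R]; rewrite setTI => <-.
apply/orP; right; apply: subset_leq_card; apply/subsetP=> _ /morphimP[r _ _ ->].
exact: ad_in_commutator_subgroup.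
Qed.

Lemma centralizer_central s : s \in rng_center R -> centralizer s = [set: R].
Proof.
by rewrite inE => /forallP sZ; apply/setP=> r; rewrite !inE; exact: sZ.
Qed.

Lemma card_commuting_pairs :
  #|[set sr : R * R | sr.1 ** sr.2 == sr.2 ** sr.1]|
  = (\sum_s #|centralizer s|)%N.
Proof.
rewrite -sum1_card; under [RHS]eq_bigr => s _ do rewrite -sum1_card.
by rewrite pair_big_dep /=; apply: eq_bigl => -[s r]; rewrite !inE.
Qed.

(** The centralizer of a central element is all of [R]; that of a non-central
    one has at least [|R| / |[R,R]|] elements.  Multiplying through by
    [|[R,R]|] keeps the count within the natural numbers. *)
Lemma commuting_pairs_lower_bound :
  (#|rng_center R| * (#|R| * #|commutator_subgroup R|)
     + #|~: rng_center R| * #|R|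
   <= #|[set sr : R * R | sr.1 ** sr.2 == sr.2 ** sr.1]|
      * #|commutator_subgroup R|)%N.
Proof.
rewrite card_commuting_pairs big_distrl (bigID (mem (rng_center R))) /=.
apply: leq_add.
  rewrite -sum_nat_const; apply: leq_sum => s sZ.
  by rewrite centralizer_central // cardsT.
rewrite -sum_nat_const; under eq_bigl => s do rewrite inE.
apply: leq_sum => s _; exact: card_le_centralizer_mul_commutator.
Qed.

Lemma commutator_subgroup_gt1 :
  ~ commutative (@rngmul R) -> (1 < #|commutator_subgroup R|)%N.
Proof.
move=> ncR; rewrite cardG_gt1; apply/trivgPn.
have [/forallP cR|] := boolP [forall s : R, forall r, s ** r == r ** s].
  by case: ncR => s r; exact: (eqP (forallP (cR s) r)).
rewrite negb_forall => /existsP[s]; rewrite negb_forall => /existsP[r sr].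
exists (ad s r); first exact: ad_in_commutator_subgroup.
by change (ad s r != 0); rewrite subr_eq0.
Qed.

End CommutingPairs.

Theorem corollary2p19 (R : finRngType) :
  (commuting_prob R >=
     1 / #|commutator_subgroup R|%:R *
     (1 + (#|commutator_subgroup R|%:R - 1)
          / #|[set: R] : rng_center R|%g%:R))
  /\ (~ commutative (@rngmul R) ->
      commuting_prob R > 1 / #|commutator_subgroup R|%:R).
Proof.
have K_gt0 : 0 < #|commutator_subgroup R|%:R :> rat by rewrite ltr0n cardG_gt0.
have i_gt0 : 0 < #|[set: R] : rng_center R|%g%:R :> rat.
  by rewrite ltr0n (indexg_gt0 [set: R]%G (rng_center_group R)).
have bound : 1 / #|commutator_subgroup R|%:R *
     (1 + (#|commutator_subgroup R|%:R - 1)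
          / #|[set: R] : rng_center R|%g%:R) <= commuting_prob R.
  have z_gt0 : 0 < #|rng_center R|%:R :> rat.
    by rewrite ltr0n (cardG_gt0 (rng_center_group R)).
  have cardR : #|R|%:R =
      #|rng_center R|%:R * #|[set: R] : rng_center R|%g%:R :> rat.
    by rewrite -natrM (Lagrange (subsetT (rng_center_group R))) cardsT.
  have := commuting_pairs_lower_bound R.
  rewrite -(ler_nat rat) natrD !natrM => le_pairs.
  have cardZC : #|~: rng_center R|%:R = #|R|%:R - #|rng_center R|%:R :> rat.
    by rewrite -(cardsC (rng_center R)) natrD addrC addKr.
  move: le_pairs K_gt0 i_gt0 z_gt0; rewrite cardZC /commuting_prob cardR.
  move: #|commutator_subgroup R|%:R #|[set: R] : _|%g%:R #|rng_center R|%:R.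
  move=> K i z le_pairs K_gt0 i_gt0 z_gt0.
  rewrite ler_pdivlMr; last by rewrite exprn_gt0 ?mulr_gt0.
  rewrite -(ler_pM2r K_gt0); apply: le_trans le_pairs.
  (* Once [|R|] is written as [|Z(R)| |R : Z(R)|], the stated bound and the
     count are the same rational function of [K], [i] and [z]. *)
  rewrite le_eqVlt; apply/orP; left; apply/eqP; field.
  by rewrite !gt_eqF.
split=> // /commutator_subgroup_gt1 K_gt1; apply: lt_le_trans bound.
rewrite ltr_pMr ?divr_gt0 // ltrDl divr_gt0 //.
by rewrite subr_gt0 ltr1n.
Qed.
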